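(* Let $G=(V_1\cup V_2,E)$ be a bipartite graph with a fixed bipartition and let $k$ be a positive integer. Suppose that none of Rules 1, 2 and 3 applies to $G$, and suppose that there exists a biclustering of $G$ of cost at most $k$. Then $G$ has at most $4.5k$ vertices.
   Context: $N(x)$ denotes the neighborhood of $x$; for a set $X$ of vertices on one side, $N(X)=\bigcup_{x\in X}N(x)$. Two vertices on the same side are twins if they have the same neighborhood; a twin class is an equivalence class of this relation (possibly a single vertex). Given a twin class $R$ with $S=N(R)$, a vertex $t\in N(S)\setminus R$ is a sister of $R$ if $t$ has no twin in $G$ and $N(t)=S\cup\{v\}$ for some vertex $v\notin S$. A bicluster is a set $X\cup Y$ with $X\subseteq V_1$, $Y\subseteq V_2$ such that $N(x)=Y$ for all $x\in X$ and $N(y)=X$ for all $y\in Y$ (an isolated vertex is a bicluster); a bicluster graph is a graph each of whose connected components is a bicluster. A biclustering of $G$ is a bicluster graph $\mathcal{B}$ with $V(\mathcal{B})=V(G)$ all of whose edges go between $V_1$ and $V_2$; its cost is $|E(G)\triangle E(\mathcal{B})|$. The reduction rules: Rule 1 applies if some connected component of $G$ is a bicluster. Rule 2 applies if there is a twin class $R$ with $|R|>|N(N(R))\setminus R|$. Rule 3 applies if there is a twin class $R$ such that, with $T$ the set of sisters of $R$ and $W=N(N(R))\setminus(R\cup T)$, we have $|R|>|W|$ and $|T|\ge 1$. *)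

(* Defs.v *)
From mathcomp Require Import all_boot all_order all_algebra.

Set Implicit Arguments.
Unset Strict Implicit.
Unset Printing Implicit Defensive.

(* A graph is a finite vertex type T with an adjacency relation e; the fixed
   bipartition is the pair of sets V1, V2, either of which may be empty.
   Irreflexivity of e follows from the disjointness of V1 and V2. *)
Definition bipartite (T : finType) (V1 V2 : {set T}) (e : rel T) : Prop :=
  [/\ V1 :|: V2 = [set: T],
      [disjoint V1 & V2],
      symmetric e
    & forall x y, e x y ->
        (x \in V1) && (y \in V2) || (x \in V2) && (y \in V1)].

Definition nbh (T : finType) (e : rel T) (x : T) : {set T} := [set y | e x y].

Definition nbhs (T : finType) (e : rel T) (X : {set T}) : {set T} :=
  \bigcup_(x in X) nbh e x.

Definition edges (T : finType) (e : rel T) : {set {set T}} :=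
  [set [set p.1; p.2] | p : T * T & e p.1 p.2].

Definition same_side (T : finType) (V1 V2 : {set T}) (x y : T) : bool :=
  (x \in V1) && (y \in V1) || (x \in V2) && (y \in V2).

(* Reflexive, so that its classes include single vertices. *)
Definition twins (T : finType) (V1 V2 : {set T}) (e : rel T) : rel T :=
  [rel x y | same_side V1 V2 x y && (nbh e x == nbh e y)].

Definition twin_class (T : finType) (V1 V2 : {set T}) (e : rel T)
    (R : {set T}) : Prop :=
  exists x : T, R = [set y | twins V1 V2 e x y].

Definition has_twin (T : finType) (V1 V2 : {set T}) (e : rel T) (t : T) : bool :=
  [exists u, (u != t) && twins V1 V2 e t u].

Definition sister (T : finType) (V1 V2 : {set T}) (e : rel T)
    (R : {set T}) (t : T) : bool :=
  let S := nbhs e R in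
  [&& t \in nbhs e S :\: R,
      ~~ has_twin V1 V2 e t
    & [exists v, (v \notin S) && (nbh e t == S :|: [set v])]].

Definition sisters (T : finType) (V1 V2 : {set T}) (e : rel T)
    (R : {set T}) : {set T} :=
  [set t | sister V1 V2 e R t].

Definition component (T : finType) (e : rel T) (C : {set T}) : Prop :=
  exists x : T, C = [set y | connect e x y].

Definition bicluster (T : finType) (V1 V2 : {set T}) (e : rel T)
    (C : {set T}) : Prop :=
  exists X Y : {set T},
    [/\ C = X :|: Y, X \subset V1, Y \subset V2,
        forall x, x \in X -> nbh e x = Y
      & forall y, y \in Y -> nbh e y = X].

Definition bicluster_graph (T : finType) (V1 V2 : {set T}) (e : rel T) : Prop :=
  forall C : {set T}, component e C -> bicluster V1 V2 e C.

Definition biclustering (T : finType) (V1 V2 : {set T}) (b : rel T) : Prop :=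
  bipartite V1 V2 b /\ bicluster_graph V1 V2 b.

Definition cost (T : finType) (e b : rel T) : nat :=
  #|(edges e :\: edges b) :|: (edges b :\: edges e)|.

Definition rule1_applies (T : finType) (V1 V2 : {set T}) (e : rel T) : Prop :=
  exists C : {set T}, component e C /\ bicluster V1 V2 e C.

Definition rule2_applies (T : finType) (V1 V2 : {set T}) (e : rel T) : Prop :=
  exists R : {set T},
    twin_class V1 V2 e R /\ #|nbhs e (nbhs e R) :\: R| < #|R|.

Definition rule3_applies (T : finType) (V1 V2 : {set T}) (e : rel T) : Prop :=
  exists R : {set T},
    let W := nbhs e (nbhs e R) :\: (R :|: sisters V1 V2 e R) in
    [/\ twin_class V1 V2 e R, #|W| < #|R| & 1 <= #|sisters V1 V2 e R|].

(* Main.v *)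
(** Fix a biclustering, described by the map sending each vertex to the name
    of its cluster, that minimises the number of edited pairs.  On one side of
    a cluster the unedited vertices are twins, so Rules 2 and 3 bound their
    number by the number of vertices at distance two that are neither twins
    nor sisters of them.  Charging the unedited vertices to those edited
    vertices, a vertex [v] with [d] edits pays for its own cluster and for the
    clusters into which it has a deleted edge, hence for at most [d + 1]
    clusters.  This is too expensive only for the vertices ("heavy" below) with
    [d = 1] paying for two clusters.  Such a vertex [x], being no sister, has a
    twin; by minimality either the twin lies in the cluster of [x], or both
    clusters involved have a side reduced to one vertex.  In each case the
    other endpoint of the edit of [x] pays little enough to compensate. *)
Require Import Defs.
From mathcomp Require Import all_boot all_order all_algebra.
From mathcomp Require Import zify.

Set Implicit Arguments.
Unset Strict Implicit.
Unset Printing Implicit Defensive.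

Section Kernel.

Variables (T : finType) (V1 V2 : {set T}) (e : rel T).
Hypothesis Gbip : bipartite V1 V2 e.

Lemma mem_side2 x : (x \in V2) = (x \notin V1).
Proof.
case: Gbip => VU /disjoint_setI0 VI _ _.
have := in_setT x; have := in_set0 x; rewrite -VU -VI !inE.
by case: (x \in V1); case: (x \in V2).
Qed.

Lemma edge_sym : symmetric e.
Proof. by case: Gbip. Qed.

Lemma edge_side x y : e x y -> (y \in V1) = (x \notin V1).
Proof.
case: Gbip => _ _ _ /(_ x y) H /H; rewrite !mem_side2.
by case: (x \in V1); case: (y \in V1).
Qed.

Lemma twinsE x y :
  twins V1 V2 e x y = ((x \in V1) == (y \in V1)) && (nbh e x == nbh e y).
Proof.
rewrite /twins /same_side /= !mem_side2.
by case: (x \in V1); case: (y \in V1).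
Qed.

Definition class_of (u : T) : {set T} := [set y | twins V1 V2 e u y].

Lemma class_of_refl u : u \in class_of u.
Proof. by rewrite inE twinsE !eqxx. Qed.

Lemma nbhs_class_of u : nbhs e (class_of u) = nbh e u.
Proof.
apply/setP => z; apply/bigcupP/idP => [[y] | uz].
  by rewrite inE twinsE => /andP[_ /eqP ->].
by exists u => //; apply: class_of_refl.
Qed.

Definition charged (u : T) : {set T} :=
  nbhs e (nbhs e (class_of u)) :\: (class_of u :|: sisters V1 V2 e (class_of u)).

Lemma chargedP u v :
  reflect ([/\ exists2 z, e u z & e z v, v \notin class_of u
             & v \notin sisters V1 V2 e (class_of u)])
          (v \in charged u).
Proof.
rewrite in_setD in_setU negb_or nbhs_class_of.
apply: (iffP andP) => [[/andP[-> ->] /bigcupP[z]]|[[z uz zv] -> ->]].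
  by rewrite !inE => uz zv; split=> //; exists z.
by split=> //; apply/bigcupP; exists z; rewrite inE.
Qed.

Lemma charged_side u v : v \in charged u -> (v \in V1) = (u \in V1).
Proof.
by case/chargedP => -[z /edge_side uz /edge_side ->] _ _; rewrite uz negbK.
Qed.

Lemma card_class_le_charged u :
  ~ rule2_applies V1 V2 e -> ~ rule3_applies V1 V2 e ->
  #|class_of u| <= #|charged u|.
Proof.
move=> no2 no3; rewrite leqNgt; apply/negP => lt_cl.
have isclass : twin_class V1 V2 e (class_of u) by exists u.
have [T0|T0] := eqVneq (sisters V1 V2 e (class_of u)) set0.
  by apply: no2; exists (class_of u); split=> //; move: lt_cl; rewrite /charged T0 setU0.
by apply: no3; exists (class_of u); split=> //; rewrite card_gt0.
Qed.

(* [f] names the cluster of each vertex. *)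
Definition edits (f : T -> T) (x : T) : {set T} :=
  [set y | ((y \in V1) == (x \notin V1)) && (e x y (+) (f x == f y))].

Lemma edits_sym f x y : (y \in edits f x) = (x \in edits f y).
Proof.
by rewrite !inE edge_sym (eq_sym (f x)); case: (x \in V1); case: (y \in V1).
Qed.

Lemma unedited_edge f x y : y \notin edits f x -> e x y -> f x = f y.
Proof.
move=> + xy; rewrite inE (edge_side xy) eqxx xy /= negbK.
by move/eqP.
Qed.

Lemma nbh_unedited f u :
  edits f u = set0 -> nbh e u = [set y | ((y \in V1) == (u \notin V1)) && (f u == f y)].
Proof.
move=> /setP u0; apply/setP => y; have := u0 y; rewrite !inE.
have [uy|] := boolP (e u y); first by rewrite (edge_side uy) eqxx /= => /negbFE ->.
by move=> _ /= ->.
Qed.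

Lemma edits_relabel (f g : T -> T) x y :
  (forall z, z != x -> g z = f z) -> y != x ->
  edits g y :\ x = edits f y :\ x.
Proof.
move=> gf yx; apply/setP => z; rewrite !inE.
by have [//|zx] := eqVneq z x; rewrite !gf.
Qed.

Lemma total_edits_split f x :
  \sum_v #|edits f v| = #|edits f x| + #|edits f x| + \sum_(v | v != x) #|edits f v :\ x|.
Proof.
rewrite (bigD1 x) //= -addnA; congr (_ + _).
rewrite (eq_bigr (fun v => (x \in edits f v) + #|edits f v :\ x|)); last first.
  by move=> v _; rewrite (cardsD1 x).
rewrite big_split /=; congr (_ + _); rewrite -sum1_card [RHS]big_mkcond /=.
rewrite [RHS](bigD1 x) //= [x \in _]inE.
have -> : ((x \in V1) == (x \notin V1)) = false by case: (x \in V1).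
rewrite add0n; apply: eq_bigr => v _.
by rewrite (edits_sym f x v); case: (_ \in _).
Qed.

Section Charging.

Variable f : T -> T.
Hypothesis f_min : forall g : T -> T, \sum_v #|edits f v| <= \sum_v #|edits g v|.
Hypothesis no_rule2 : ~ rule2_applies V1 V2 e.
Hypothesis no_rule3 : ~ rule3_applies V1 V2 e.

Definition charges (v : T) : {set T} :=
  [set l | [exists u, [&& edits f u == set0, f u == l & v \in charged u]]].

Lemma chargesP v l :
  reflect (exists u, [/\ edits f u = set0, f u = l & v \in charged u])
          (l \in charges v).
Proof.
rewrite inE; apply: (iffP existsP) => [[u /and3P[/eqP u0 /eqP ul uv]]|[u [u0 ul uv]]].
  by exists u.
by exists u; rewrite u0 ul uv !eqxx.
Qed.

Lemma charges_unedited v : edits f v = set0 -> charges v = set0.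
Proof.
move=> v0; apply/eqP; apply: contraT => /set0Pn[l /chargesP[u [u0 _ uv]]].
have us := charged_side uv.
case/chargedP: uv => -[z uz zv] vR _.
have fuz : f u = f z by apply: unedited_edge uz; rewrite u0 inE.
have fvz : f v = f z by apply: unedited_edge (_ : e v z); rewrite ?v0 ?inE // edge_sym.
case/negP: vR; rewrite inE twinsE us eqxx /=.
by rewrite (nbh_unedited u0) (nbh_unedited v0) us fuz fvz.
Qed.

Lemma charges_sub v : charges v \subset f v |: (f @: edits f v).
Proof.
apply/subsetP => l /chargesP[u [u0 <- /chargedP[[z uz zv] _ _]]].
have -> : f u = f z by apply: unedited_edge uz; rewrite u0 inE.
rewrite 2!inE; have [//|zNv] := eqVneq (f z) (f v); apply/imsetP; exists z => //.
by rewrite edge_sym in zv; rewrite inE (edge_side zv) eqxx zv eq_sym (negbTE zNv).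
Qed.

Lemma card_charges_le v : #|charges v| <= #|edits f v|.+1.
Proof.
apply: leq_trans (subset_leq_card (charges_sub v)) _.
rewrite cardsU1; have := leq_imset_card f (edits f v).
by case: (_ \notin _); lia.
Qed.

Lemma card_le_charges :
  #|T| <= \sum_v ((edits f v != set0) + #|charges v|).
Proof.
rewrite big_split /= -(cardC [pred v | edits f v != set0]) -sum1_card.
rewrite big_mkcond /=.
apply: leq_add; first by apply: leq_sum => v _; rewrite inE; case: (_ != _).
rewrite -sum1_card (partition_big (fun v => (f v, v \in V1)) xpredT) //=.
pose cnt (p : T * bool) := \sum_(v | (v \in V1) == p.2) (p.1 \in charges v).
apply: (@leq_trans (\sum_p cnt p)).
  apply: leq_sum => -[l s] _; rewrite /cnt /= sum1_card.
  pose U := [pred v | (edits f v == set0) && ((f v, v \in V1) == (l, s))].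
  rewrite (eq_card (B := U)); last by move=> v; rewrite unfold_in /= !inE negbK.
  have [u /andP[/eqP u0 /eqP[ul us]]|U0] := pickP U; last by rewrite eq_card0.
  apply: (@leq_trans #|class_of u|).
    apply/subset_leq_card/subsetP => v.
    rewrite !inE => /andP[/eqP v0 /eqP[vl vs]].
    rewrite twinsE us vs eqxx /=.
    by rewrite (nbh_unedited u0) (nbh_unedited v0) us vs ul vl.
  apply: leq_trans (card_class_le_charged u no_rule2 no_rule3) _.
  rewrite -sum1_card big_mkcond [X in _ <= X]big_mkcond /=.
  apply: leq_sum => v _; case: ifP => // uv.
  rewrite (charged_side uv) us eqxx.
  by have -> : l \in charges v by apply/chargesP; exists u.
rewrite -(pair_bigA _ (fun l s => cnt (l, s))) /= /cnt /=.
under eq_bigr => l _.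
  rewrite (_ : \sum_s _ = \sum_v (l \in charges v)); last first.
    by rewrite [RHS](partition_big (fun v => v \in V1) xpredT).
  over.
rewrite exchange_big /=; apply: leq_sum => v _.
by rewrite -sum1_card [X in _ <= X]big_mkcond; apply: leq_sum => l _; case: (_ \in _).
Qed.

Definition heavy (x : T) : bool := (#|edits f x| == 1) && (1 < #|charges x|).

Lemma edits_move_to_twin x (g : T -> T) y :
  twins V1 V2 e x y -> g y = f x -> (forall z, z != y -> g z = f z) ->
  edits g y = edits f x.
Proof.
rewrite twinsE => /andP[/eqP xy /eqP nxy] gy gz; apply/setP => z; rewrite !inE -xy gy.
have /setP/(_ z) := nxy; rewrite !inE => <-.
have [-> |zy] := eqVneq z y; last by rewrite gz.
by rewrite -xy; case: (x \in V1).
Qed.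

Lemma twin_edits_le x y : twins V1 V2 e x y -> #|edits f y| <= #|edits f x|.
Proof.
move=> xy; pose g z := if z == y then f x else f z.
have gz z : z != y -> g z = f z by rewrite /g => /negbTE ->.
have gy : g y = f x by rewrite /g eqxx.
have := f_min g; rewrite !(total_edits_split _ y) (edits_move_to_twin xy gy gz).
have -> : \sum_(v | v != y) #|edits g v :\ y| = \sum_(v | v != y) #|edits f v :\ y|.
  by apply: eq_bigr => v vy; rewrite (edits_relabel gz vy).
lia.
Qed.

Lemma heavy_partner x y :
  heavy x -> y \in edits f x ->
  #|charges y| < #|edits f y| \/ 1 < #|edits f y| /\ #|charges y| <= #|edits f y|.
Proof.
case/andP => /cards1P[y' Dx] Px; rewrite Dx => /set1P ?; subst y'.
have sub : charges x \subset [set f x; f y].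
  by have := charges_sub x; rewrite Dx imset_set1.
have /eqP Pxy : charges x == [set f x; f y].
  by rewrite eqEcard sub cards2; case: (_ != _) => //; exact: ltnW.
have fxy : f x != f y by move: Px; rewrite Pxy cards2; case: (_ != _).
have yDx : y \in edits f x by rewrite Dx set11.
have xDy : x \in edits f y by rewrite edits_sym.
have exy : e x y.
  by move: yDx; rewrite inE (negbTE fxy); case: (e x y); rewrite // andbF.
have : f x \in charges x by rewrite Pxy !inE eqxx.
case/chargesP => u [u0 fux ux]; have us := charged_side ux.
case/chargedP: (ux) => -[z uz zx] xR xNs.
have Nu := nbh_unedited u0.
have Nx : nbh e x = nbh e u :|: [set y].
  apply/setP => t; rewrite Nu !inE -us fux.
  have [->|ty] := eqVneq t y; first by rewrite orbT exy.
  have : t \notin edits f x by rewrite Dx inE.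
  rewrite inE orbF; have [et|_ /=] := boolP (e x t).
    by rewrite (edge_side et) eqxx /= => /negbNE ->.
  by move/negbTE->.
have yNu : y \notin nbh e u by rewrite Nu inE fux (negbTE fxy) andbF.
have /existsP[x2 /andP[x2x xx2]] : has_twin V1 V2 e x.
  apply: contraR xNs => notwin; rewrite inE /sister notwin nbhs_class_of /=.
  rewrite inE xR; apply/andP; split.
    by apply/bigcupP; exists z; rewrite inE.
  by apply/existsP; exists y; rewrite yNu Nx eqxx.
have le2 : #|edits f x2| <= 1 by rewrite -[1](cards1 y) -Dx; apply: twin_edits_le.
move: (xx2); rewrite twinsE => /andP[/eqP sx2 /eqP Nx2].
have ex2 t : e x2 t = e x t by have /setP/(_ t) := Nx2; rewrite !inE.
have [fx2|fx2] := eqVneq (f x2) (f x).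
  right.
  have x2Dy : x2 \in edits f y.
    by rewrite edits_sym inE -sx2 (edge_side exy) eqxx ex2 exy fx2 (negbTE fxy).
  split; first by apply/card_gt1P; exists x, x2; split=> //; rewrite eq_sym.
  have lt_im : #|f @: edits f y| < #|edits f y|.
    rewrite ltn_neqAle leq_imset_card andbT; apply/imset_injP => inj.
    by case/eqP: x2x; apply: inj.
  apply: leq_trans (subset_leq_card (charges_sub y)) _; rewrite cardsU1.
  by apply: leq_trans lt_im; rewrite -add1n leq_add2r leq_b1.
left.
(* Moving the twin [x2] into the cluster of [x] leaves it with one edit, so by
   minimality [x2] has at most one edit already; this makes [z] and [y] the
   only vertices on their side of the clusters of [x] and [x2]. *)
have Dx2 t : e u t -> t \in edits f x2.
  move=> ut; have ext : e x t by have /setP/(_ t) := Nx; rewrite !inE ut.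
  have fut : f u = f t by apply: unedited_edge ut; rewrite u0 inE.
  by rewrite inE -sx2 (edge_side ext) eqxx ex2 ext -fut fux (negbTE fx2).
have edit1 t : t \in edits f x2 -> t = z.
  by move=> tD; apply: (card_le1_eqP le2) => //; apply: Dx2.
have yz : y != z by apply: contraNneq yNu => ->; rewrite inE.
have fy2 : f x2 = f y.
  by apply: unedited_edge (_ : e x2 y); [apply: contra_neqN yz => /edit1 | rewrite ex2].
have fyN : f y \notin charges y.
  apply/chargesP => -[w [w0 fw yw]]; have ws := charged_side yw.
  have wy : w = y.
    have [ew|ew] := boolP (e x w).
      have : w \in nbh e x by rewrite inE.
      rewrite Nx Nu !inE => /orP[/andP[_ /eqP fuw]|/eqP //].
      by rewrite -fw -fuw fux eqxx in fxy.
    have : w \in edits f x2.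
      by rewrite inE -ws -sx2 (edge_side exy) eqxx ex2 (negbTE ew) fy2 fw eqxx.
    move=> /edit1 wz; move: fxy; rewrite -fw wz -fux.
    by rewrite (unedited_edge (_ : z \notin edits f u) uz) ?eqxx // u0 inE.
  by move: xDy; rewrite -wy w0 inE.
have fxN : f x \notin charges y.
  apply/chargesP => -[w [w0 fw yw]]; have ws := charged_side yw.
  have : w \in nbh e u by rewrite Nu inE -ws -us (edge_side exy) eqxx fux fw eqxx.
  by rewrite inE => /Dx2; rewrite edits_sym w0 inE.
have sub2 : charges y \subset f @: (edits f y :\ x).
  apply/subsetP => l lP; have := subsetP (charges_sub y) l lP.
  rewrite in_setU1 => /orP[/eqP ly|/imsetP[d dD ld]]; first by rewrite -ly lP in fyN.
  apply/imsetP; exists d => //; rewrite !inE in dD *; rewrite dD andbT.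
  by apply: contraNneq fxN => <-; rewrite -ld.
rewrite (cardsD1 x (edits f y)) xDy add1n ltnS.
exact: leq_trans (subset_leq_card sub2) (leq_imset_card _ _).
Qed.

Lemma weight_le v :
  4 * ((edits f v != set0) + #|charges v|) + 3 * #|[set x in edits f v | heavy x]|
    <= 9 * #|edits f v| + 3 * heavy v.
Proof.
set B := [set x in _ | _].
have BD : #|B| <= #|edits f v|.
  by apply/subset_leq_card/subsetP => x; rewrite inE => /andP[].
have [D0|D0] := eqVneq (edits f v) set0.
  by move: BD; rewrite charges_unedited // D0 cards0; lia.
have Dgt0 : 0 < #|edits f v| by rewrite card_gt0.
have Pv := card_charges_le v.
have [B0|/set0Pn[x]] := eqVneq B set0.
  rewrite B0 cards0 /heavy.
  by case: eqP => /= [D1|D1]; [case: ltnP => ? | ]; lia.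
rewrite inE => /andP[xD hx].
have := heavy_partner hx (_ : v \in edits f x); rewrite edits_sym => /(_ xD).
by case; lia.
Qed.

Lemma card_le_total_edits : 4 * #|T| <= 9 * \sum_v #|edits f v|.
Proof.
have heavyE : \sum_v #|[set x in edits f v | heavy x]| = \sum_v (heavy v : nat).
  under eq_bigr => v _ do rewrite -sum1dep_card big_mkcond /=.
  rewrite exchange_big /=; apply: eq_bigr => x _.
  have [hx|hx] := boolP (heavy x); last by rewrite big1 // => v _; rewrite andbF.
  have /andP[/eqP Dx1 _] := hx; rewrite -[RHS]Dx1 -sum1_card [RHS]big_mkcond /=.
  by apply: eq_bigr => v _; rewrite andbT edits_sym.
have : 4 * (\sum_v ((edits f v != set0) + #|charges v|))
         + 3 * \sum_v #|[set x in edits f v | heavy x]|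
       <= 9 * (\sum_v #|edits f v|) + 3 * \sum_v (heavy v : nat).
  by rewrite !big_distrr -!big_split; apply: leq_sum => v _; apply: weight_le.
rewrite heavyE; have := card_le_charges; lia.
Qed.

End Charging.

Lemma card_le_total_edits_any (f : T -> T) :
  ~ rule2_applies V1 V2 e -> ~ rule3_applies V1 V2 e ->
  4 * #|T| <= 9 * \sum_v #|edits f v|.
Proof.
move=> no2 no3; pose tot (g : {ffun T -> T}) := \sum_v #|edits g v|.
have totE (g : T -> T) : \sum_v #|edits g v| = tot (finfun g).
  apply: eq_bigr => v _; apply: eq_card => y; rewrite !inE.
  by rewrite !ffunE.
pose g := [arg min_(h < finfun f) tot h].
have gmin h : tot g <= tot h by rewrite /g; case: arg_minnP => // ? _; apply.
have le4 : 4 * #|T| <= 9 * tot g.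
  by apply: card_le_total_edits => // h; rewrite (totE h); apply: gmin.
by rewrite totE; have := gmin (finfun f); lia.
Qed.

End Kernel.

Lemma set2_eq (T : finType) (a b c d : T) :
  [set a; b] = [set c; d] -> (a = c /\ b = d) \/ (a = d /\ b = c).
Proof.
move=> /setP E; have := E a; have := E b; have := E c; have := E d.
rewrite !inE !eqxx !orbT /= => /orP dE /orP cE /esym/orP bE /esym/orP[]/eqP ?; subst a.
  left; split=> //; case: bE => /eqP // ?; subst b.
  by case: dE => /eqP.
right; split=> //; case: bE => /eqP // ?; subst b.
by case: cE => /eqP.
Qed.

Lemma mem_edges (T : finType) (e : rel T) (x y : T) :
  symmetric e -> ([set x; y] \in edges e) = e x y.
Proof.
move=> esym; apply/imsetP/idP => [[[a b]]|xy].
  by rewrite inE /= => ab /set2_eq[[-> ->] | [-> ->]]; rewrite // esym.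
by exists (x, y); rewrite ?inE.
Qed.

Lemma biclustering_root (T : finType) (V1 V2 : {set T}) (b : rel T) (x y : T) :
  biclustering V1 V2 b -> (y \in V1) = (x \notin V1) ->
  b x y = (fingraph.root b x == fingraph.root b y).
Proof.
move=> [bbip bclus].
have bsym := edge_sym bbip.
wlog xV1 : x y / x \in V1 => [W|].
  have [xV1|xV1] := boolP (x \in V1); first by move=> xy; apply: W; rewrite // xV1.
  by move=> yV1; rewrite bsym eq_sym; apply: W; rewrite yV1 // (negbTE xV1).
rewrite xV1 /= => yV1.
rewrite root_connect; last by apply: sym_connect_sym.
apply/idP/idP => [|cxy]; first exact: connect1.
have [X [Y [C XV YV NX _]]] := bclus _ (ex_intro _ x erefl).
have /setP/(_ x) := C; have /setP/(_ y) := C; rewrite !inE cxy connect0.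
have -> : y \in X = false by apply/negP => /(subsetP XV); rewrite yV1.
have -> : x \in Y = false.
  by apply/negP => /(subsetP YV); rewrite (mem_side2 bbip) xV1.
rewrite orbF orFb => /esym yY /esym xX; have /setP/(_ y) := NX x xX.
by rewrite inE yY.
Qed.

Lemma total_edits_le_cost (T : finType) (V1 V2 : {set T}) (e b : rel T) :
  bipartite V1 V2 e -> biclustering V1 V2 b ->
  \sum_v #|edits V1 e (fingraph.root b) v| <= (cost e b).*2.
Proof.
move=> ebip bclus; have esym := edge_sym ebip.
have bsym : symmetric b by case: bclus => /edge_sym.
pose Q s := [set p : T * T | ((p.1 \in V1) == s) && (p.2 \in edits V1 e (fingraph.root b) p.1)].
have Qle s : #|Q s| <= cost e b.
  rewrite -(card_in_imset (f := fun p : T * T => [set p.1; p.2])).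
    apply/subset_leq_card/subsetP => _ /imsetP[[x y] + ->] /=.
    rewrite !inE /= !mem_edges // => /andP[_ /andP[/eqP yx]].
    by rewrite -(biclustering_root bclus yx); case: (e x y); case: (b x y).
  move=> [x y] [x' y'] /=; rewrite !inE /=.
  move=> /andP[/eqP xs /andP[/eqP ys _]] /andP[/eqP xs' /andP[/eqP ys' _]].
  move=> /set2_eq[[-> ->] // | [xy' yx']].
  by move: ys; rewrite yx' xs' xs; case: (s).
have -> : \sum_v #|edits V1 e (fingraph.root b) v| = #|Q true| + #|Q false|.
  rewrite -!sum1dep_card [X in X + _]big_mkcond [X in _ + X]big_mkcond -big_split /=.
  rewrite -(pair_bigA _ (fun x y =>
    (if ((x \in V1) == true) && (y \in edits V1 e (fingraph.root b) x) then 1 else 0)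
    + (if ((x \in V1) == false) && (y \in edits V1 e (fingraph.root b) x) then 1 else 0))).
  apply: eq_bigr => x _; rewrite -sum1_card big_mkcond; apply: eq_bigr => y _ /=.
  by case: (x \in V1); case: (y \in _).
by rewrite -addnn; apply: leq_add.
Qed.

Theorem theorem1 (T : finType) (V1 V2 : {set T}) (e : rel T) (k : nat)
    (Gbip : bipartite V1 V2 e)
    (k_gt0 : 0 < k)
    (no_rule1 : ~ rule1_applies V1 V2 e)
    (no_rule2 : ~ rule2_applies V1 V2 e)
    (no_rule3 : ~ rule3_applies V1 V2 e)
    (has_biclustering :
       exists b : rel T, biclustering V1 V2 b /\ cost e b <= k) :
  (#|T|%:R <= 4.5%Q * k%:R)%R.
Proof.
case: has_biclustering => b [bclus cost_le].
have le1 := card_le_total_edits_any Gbip (fingraph.root b) no_rule2 no_rule3.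
have le2 := total_edits_le_cost Gbip bclus.
have le3 : 2 * #|T| <= 9 * k by lia.
have -> : 4.5%Q = (9%:R / 2%:R)%R by apply/eqP.
rewrite GRing.mulrAC Num.Theory.ler_pdivlMr //.
by rewrite -!GRing.natrM Num.Theory.ler_nat mulnC.
Qed.
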